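(* Let $e_1,\dots,e_m$ be any multigraph edge stream, $\alpha,\beta\in(0,1)$, $\Delta t\ge0$, and run MG-Triangle$(\alpha,\beta,\Delta t)$ as described in the context. For every time $t$, after processing $e_t$, the expected size of \textit{e-list} is $\alpha\,|E(G[1,t])|$ and the expected size of \textit{w-list} is $\alpha^2\beta\,|W(G[1,t])|$.
   Context: A multigraph edge stream is a sequence $e_1,\dots,e_m$ of unordered pairs of distinct vertex ids; the same pair may occur several times. For $t'\le t$, $G[t',t]$ denotes the simple undirected graph whose edge set is the set of distinct pairs among $e_{t'},\dots,e_t$; $E(G)$ is its edge set. A wedge is a path of length $2$, i.e. an unordered pair of distinct edges $\{(u,v),(u,w)\}$ sharing exactly one vertex $u$; its closing edge is $(v,w)$. $W(G)$ is the set of wedges of a simple graph $G$. $hash$ is a uniformly random function assigning to every edge and every wedge an independent uniform value in $(0,1)$. Algorithm MG-Triangle$(\alpha,\beta,\Delta t)$ keeps a set \textit{e-list} of edges, a set \textit{w-list} of wedges, and for each $w\in$ \textit{w-list} a bit $X_w$; all start empty. For each $t=1,\dots,m$, on seeing $e_t$: (1) Update: if $hash(e_t)\le\alpha$ and $e_t\notin$ \textit{e-list}, insert $e_t$ into \textit{e-list}, and for each wedge $w=\{e,e_t\}$ with $e\in$ \textit{e-list}, if $hash(w)\le\beta$ and $w\notin$ \textit{w-list}, insert $w$ into \textit{w-list} (with $X_w=0$). (2) For each $w=\{(u,v),(u,w')\}\in$ \textit{w-list}: if $e_t$ is the closing edge $(v,w')$ set $X_w=1$; else if $e_t\in\{(u,v),(u,w')\}$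 reset $X_w=0$. (3) Output estimates computed from wedges in \textit{w-list} lying in the window graph $G[\max(1,t-\Delta t),t]$ (outputs do not modify the lists). *)

(* Defs.v *)
From HB Require Import structures.
From mathcomp Require Import all_boot all_order all_algebra finmap.
From mathcomp Require Import all_classical all_reals all_analysis.

Set Implicit Arguments.
Unset Strict Implicit.
Unset Printing Implicit Defensive.

Import Order.TTheory GRing.Theory Num.Theory.

Local Open Scope fset_scope.
Local Open Scope ring_scope.

Record edge (V : choiceType) := Edge {
  ends : {fset V};
  _ : #|` ends| == 2 }.

HB.instance Definition _ V := [isSub for @ends V].
HB.instance Definition _ V := [Choice of edge V by <:].

(* [p] is an unordered pair of edges with exactly one common vertex; the two
   edges are then automatically distinct. *)
Definition is_wedge (V : choiceType) (p : {fset edge V}) : bool :=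
  [exists e : p, exists f : p,
    (p == [fset val e; val f]) && (#|` ends (val e) `&` ends (val f)| == 1)].

Record wedge (V : choiceType) := Wedge {
  legs : {fset edge V};
  _ : is_wedge legs }.

HB.instance Definition _ V := [isSub for @legs V].
HB.instance Definition _ V := [Choice of wedge V by <:].

(* For the wedge {(u,v),(u,w)}, the closing edge (v,w) consists of the
   vertices lying on exactly one of the two legs. *)
Definition closes (V : choiceType) (g : edge V) (w : wedge V) : bool :=
  [exists e : legs w, exists f : legs w,
    (val e != val f) &&
    (ends g == (ends (val e) `\` ends (val f))
               `|` (ends (val f) `\` ends (val e)))].

(* A simple graph is represented by its set of edges. [graph s t' t] is the
   edge set of G[t',t], times being counted from 1. *)
Definition graph (V : choiceType) (s : seq (edge V)) (t' t : nat) :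
    {fset edge V} :=
  [fset e in drop t'.-1 (take t s)].

Definition wedges (V : choiceType) (E : {fset edge V}) : {fset wedge V} :=
  [fset w in pmap (insub : _ -> option (wedge V)) (enum_fset (fpowerset E))].

Lemma in_wedges (V : choiceType) (E : {fset edge V}) (w : wedge V) :
  (w \in wedges E) = (legs w `<=` E).
Proof.
rewrite !inE mem_pmap -fpowersetE; apply/mapP/idP => [[p pE]|wE].
  by case: insubP => // u _ up [->]; rewrite -up in pE.
by exists (legs w) => //; rewrite (valK w).
Qed.

(* [closed_bit w] is the bit X_w; it is meaningful only for [w] in [w_list]. *)
Record mg_state (V : choiceType) := MGState {
  e_list : {fset edge V};
  w_list : {fset wedge V};
  closed_bit : wedge V -> bool }.

Section MGTriangle.
Variables (R : realType) (V : choiceType).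

(* The outputs are estimates whose formula is left arbitrary: at time [t],
   [est t] is applied to the bits of the listed wedges lying in the window. *)
Variables (alpha beta : R) (dt : nat).
Variables (Out : Type) (est : nat -> {fmap wedge V -> bool} -> Out).
Variables (h : edge V + wedge V -> R) (s : seq (edge V)).

Definition mg_init : mg_state V := MGState fset0 fset0 (fun=> false).

Definition mg_update (e : edge V) (st : mg_state V) : mg_state V :=
  if (h (inl e) <= alpha) && (e \notin e_list st) then
    let el := e |` e_list st in
    let fresh := [fset w in pmap (fun f => insub [fset f; e]) (enum_fset el)
                 | (h (inr w) <= beta) && (w \notin w_list st)] in
    MGState el (fresh `|` w_list st)
      (fun w => if w \in fresh then false else closed_bit st w)
  else st.

Definition mg_bits (e : edge V) (st : mg_state V) : mg_state V :=
  MGState (e_list st) (w_list st)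
    (fun w => if w \notin w_list st then closed_bit st w
              else if closes e w then true
              else if e \in legs w then false
              else closed_bit st w).

Definition mg_output (t : nat) (st : mg_state V) : Out :=
  let visible := w_list st `&` wedges (graph s (maxn 1 (t - dt)) t) in
  est t [fmap w : visible => closed_bit st (val w)].

Definition mg_step (c : mg_state V * seq Out) (te : nat * edge V) :=
  let st := mg_bits te.2 (mg_update te.2 c.1) in
  (st, rcons c.2 (mg_output te.1 st)).

(* State of the algorithm, with all outputs so far, after processing e_t. *)
Definition mg_triangle (t : nat) : mg_state V * seq Out :=
  foldl mg_step (mg_init, [::]) (take t (zip (iota 1 (size s)) s)).

End MGTriangle.

Local Open Scope classical_set_scope.

Definition mutually_independent (R : realType) (d : measure_display)
    (T : measurableType d) (P : probability T R) (I : choiceType)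
    (Y : I -> {RV P >-> R}) : Prop :=
  forall (J : {fset I}) (B : I -> set R),
    (forall i, i \in J -> measurable (B i)) ->
    (P (\bigcap_(i in [set` J]) (Y i @^-1` B i)) =
     \prod_(i <- J) P (Y i @^-1` B i))%E.

(* [uniform_prob] is given by the density 1 on [0,1]; as endpoints are null,
   it is also the uniform law on (0,1). *)
Definition random_hash (R : realType) (d : measure_display)
    (T : measurableType d) (P : probability T R) (V : choiceType)
    (hash : edge V + wedge V -> {RV P >-> R}) : Prop :=
  (forall k, forall A : set R, measurable A ->
     distribution P (hash k) A = uniform_prob (@ltr01 R) A) /\
  mutually_independent hash.

(* Main.v *)
(** The random lists do not depend on the order of the stream: after [e_t],
e-list consists of the edges of G[1,t] whose hash is at most [alpha], and
w-list of the wedges with both legs in e-list and hash at most [beta].  Indeed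
a wedge is examined exactly when its second sampled leg enters e-list.  An edge
thus survives with probability [alpha], a wedge, by independence of three
hashes, with probability [alpha^2 beta], and linearity of expectation
concludes. *)

Require Import Defs.
From mathcomp Require Import all_boot all_order all_algebra finmap.
From mathcomp Require Import all_classical all_reals all_analysis measurable_realfun.

Import Order.TTheory GRing.Theory Num.Theory.

Local Open Scope ring_scope.

Section Wedge.
Context {V : choiceType}.
Local Open Scope fset_scope.

(** An edge meets itself in both of its endpoints, so legs sharing exactly one vertex must be
    distinct. *)
Lemma wedgeP (p : {fset edge V}) : is_wedge p ->
  exists e f : edge V, e != f /\ p = [fset e; f].
Proof.
case/existsP => e /existsP[f /andP[/eqP pE ef1]].
exists (val e), (val f); split=> //.
apply: contraL ef1 => /eqP <-; rewrite fsetIid.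
by case: (val e) => q /= /eqP ->.
Qed.

Lemma card_legs (w : wedge V) : #|` legs w| = 2.
Proof.
by case: w => p /= /wedgeP[e [f [ef ->]]]; rewrite cardfs2 ef.
Qed.

Lemma mem_leg (w : wedge V) (e : edge V) : e \in legs w ->
  exists2 f, f \in legs w & legs w = [fset f; e].
Proof.
case: w => p /= /wedgeP[a [b [_ ->]]]; rewrite in_fset2 => /orP[]/eqP ->.
  by exists b; rewrite ?fset22 // fsetUC.
by exists a; rewrite ?fset21.
Qed.

End Wedge.

Section SampledLists.
Context {R : realType} {V : choiceType} {Out : Type}.
Variables (alpha beta : R) (h : edge V + wedge V -> R).

Local Open Scope fset_scope.

(** The loop invariant. The wedge clause refers to the current [e_list] rather than to [l], so an
    update only has to account for wedges gained through the new edge. The bits are left free, since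
    they never influence the lists. *)
Definition sampled_lists (l : seq (edge V)) (st : mg_state V) : Prop :=
  (forall e, (e \in e_list st) = (e \in l) && (h (inl e) <= alpha)) /\
  (forall w, (w \in w_list st) =
    (legs w `<=` e_list st) && (h (inr w) <= beta)).

Lemma sampled_lists_init : sampled_lists [::] (mg_init V).
Proof.
split=> [e|w] /=; first by rewrite inE.
by rewrite inE fsubset0 -cardfs_eq0 card_legs.
Qed.

Lemma sampled_lists_update (l : seq (edge V)) (st : mg_state V) (e : edge V) :
  sampled_lists l st ->
  sampled_lists (rcons l e) (mg_update alpha beta h e st).
Proof.
move=> [elE wlE]; rewrite /mg_update; case: ifPn => [/andP[he eN]|eold].
  split=> [f|w] /=.
    rewrite in_fset1U mem_rcons in_cons elE.
    by case: (eqVneq f e) => [->|].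
  rewrite in_fsetU !inE /= wlE.
  have [hw|] := boolP (h (inr w) <= beta); last by rewrite !andbF.
  rewrite !andbT /=.
  (* By the invariant, a wedge of small hash with both legs already sampled is listed before the
     update. *)
  have [wst|wst] := boolP (legs w `<=` e_list st).
    by rewrite orbT (fsubset_trans wst) // fsubsetU1.
  rewrite orbF andbT mem_pmap; apply/mapP/idP => [[f fel]|wel].
    (* [insub] discards the pairs that are not wedges, among them the degenerate pair of [e] with
       itself. *)
    case: insubP => // u _ uE [->]; rewrite uE.
    by apply/fsubsetP => g; rewrite in_fset2 => /orP[]/eqP -> //; rewrite fset1U1.
  (* The legs lie in the new list but not in the old one, so the only added edge must be a leg; the
     wedge is then found when [e] is paired with its other leg. *)
  have ew : e \in legs w.
    apply: contraR wst => ew; apply/fsubsetP => f fw.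
    move/fsubsetP: wel => /(_ f fw); rewrite in_fset1U => /orP[/eqP fe|//].
    by rewrite fe (negbTE ew) in fw.
  have [f fw wE] := mem_leg w e ew.
  exists f; first exact: (fsubsetP wel).
  by rewrite -wE (valK w).
(* Here [e] either hashes above [alpha] or is a repetition of a sampled edge; in both cases the
   unchanged lists still fit the longer stream. *)
split=> // f; rewrite mem_rcons in_cons elE.
case: (eqVneq f e) => [->|//] /=; move: eold; rewrite elE.
by case: (h (inl e) <= alpha); rewrite ?andbF //= andbT negbK.
Qed.

(** Only [l] is subject to induction: [s] and the time stamps affect nothing but the outputs, and
    [mg_bits] keeps both lists. *)
Lemma sampled_lists_foldl (dt : nat) (est : nat -> {fmap wedge V -> bool} -> Out)
    (s : seq (edge V)) (l : seq (nat * edge V)) :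
  sampled_lists (unzip2 l)
    (foldl (mg_step alpha beta dt est h s) (mg_init V, [::]) l).1.
Proof.
elim/last_ind: l => [|l te IHl]; first exact: sampled_lists_init.
rewrite foldl_rcons /unzip2 map_rcons /=.
exact: sampled_lists_update IHl.
Qed.

Lemma sampled_lists_mg_triangle (dt : nat)
    (est : nat -> {fmap wedge V -> bool} -> Out) (s : seq (edge V)) (t : nat) :
  sampled_lists (take t s) (mg_triangle alpha beta dt est h s t).1.
Proof.
have -> : take t s = unzip2 (take t (zip (iota 1 (size s)) s)).
  by rewrite /unzip2 map_take -/unzip2 unzip2_zip // size_iota.
exact: sampled_lists_foldl.
Qed.

Lemma e_list_mg_triangle (dt : nat)
    (est : nat -> {fmap wedge V -> bool} -> Out) (s : seq (edge V)) (t : nat) :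
  e_list (mg_triangle alpha beta dt est h s t).1 =
  [fset e in graph s 1 t | h (inl e) <= alpha].
Proof.
have [elE _] := sampled_lists_mg_triangle dt est s t.
by apply/fsetP => e; rewrite elE !inE /= drop0.
Qed.

Lemma w_list_mg_triangle (dt : nat)
    (est : nat -> {fmap wedge V -> bool} -> Out) (s : seq (edge V)) (t : nat) :
  w_list (mg_triangle alpha beta dt est h s t).1 =
  [fset w in wedges (graph s 1 t)
     | (h (inr w) <= beta) && all (fun e => h (inl e) <= alpha) (legs w)].
Proof.
have [_ wlE] := sampled_lists_mg_triangle dt est s t.
apply/fsetP => w; rewrite wlE e_list_mg_triangle in_fset /= inE in_wedges.
rewrite [RHS]andbCA [LHS]andbC; congr (_ && _).
apply/fsubsetP/andP => [wel|[/fsubsetP wG /allP wa] e ew].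
  split; first by apply/fsubsetP => e /wel; rewrite in_fset /= inE => /andP[].
  by apply/allP => e /wel; rewrite in_fset /= inE => /andP[].
by rewrite in_fset /= inE wG //= wa.
Qed.

End SampledLists.

Section Probability.
Context {R : realType} {d : measure_display} {T : measurableType d}.
Variable P : probability T R.
Local Open Scope ereal_scope.
Local Open Scope classical_set_scope.

(** The ray meets the unit interval in [[0, a]], where the density is 1. *)
Lemma uniform_prob_ray (a : R) : (0 < a < 1)%R ->
  uniform_prob (@ltr01 R) [set x | (x <= a)%R] = a%:E.
Proof.
move=> /andP[a0 a1]; rewrite /uniform_prob integral_uniform_pdf.
have -> : [set x | (x <= a)%R] `&` `[0%R, 1%R] = `[0%R, a].
  apply/seteqP; split=> x /=; rewrite !in_itv /=.
    by move=> [-> /andP[-> _]].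
  by move=> /andP[-> xa]; split=> //=; rewrite (le_trans xa (ltW a1)).
rewrite (eq_integral (fun=> 1%:E)).
  by rewrite integral_cst //= lebesgue_measure_itv /= lte_fin a0 sube0 mul1e.
move=> x; rewrite inE /= in_itv /= => /andP[x0 xa].
by rewrite /uniform_pdf x0 (le_trans xa (ltW a1)) subr0 invr1.
Qed.

(** Linearity of expectation: the cardinality is a finite sum of indicators, and nonnegativity
    allows exchanging sum and integral. *)
Lemma expectation_card_filter (I : choiceType) (S : {fset I})
    (p : T -> pred I) :
  (forall i, measurable [set x | p x i]) ->
  'E_P[fun x => #|` [fset i in S | p x i]%fset|%fset%:R] =
  \sum_(i <- S) P [set x | p x i].
Proof.
move=> mp; rewrite unlock.
under eq_integral => x _.
  rewrite card_fset_sum1 -big_fset_condE big_mkcond natr_sum /= -sumEFin.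
  under eq_bigr => i _.
    have -> : (if p x i then 1 else 0)%N%:R = \1_[set y | p y i] x :> R.
      rewrite indicE; case: ifPn => pxi; first by rewrite mem_set.
      by rewrite memNset //=; apply/negP.
    over.
  over.
rewrite ge0_integral_sum //.
- by apply: eq_bigr => i _; rewrite integral_indic // setIT.
- by move=> i; apply/measurable_EFinP/measurable_indic.
Qed.

End Probability.

Section Hash.
Context {R : realType} {d : measure_display} {T : measurableType d}.
Context {P : probability T R} {V : choiceType}.
Variable hash : edge V + wedge V -> {RV P >-> R}.
Hypothesis hash_random : random_hash hash.
Local Open Scope ereal_scope.
Local Open Scope classical_set_scope.

Let measurable_ray (a : R) : measurable [set x : R | (x <= a)%R].
Proof. by rewrite -set_itvNyc. Qed.

Lemma measurable_hash_le (k : edge V + wedge V) (a : R) :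
  measurable [set x | (hash k x <= a)%R].
Proof.
have -> : [set x | (hash k x <= a)%R] = hash k @^-1` [set y | (y <= a)%R] by [].
by rewrite -[X in measurable X]setTI; exact: measurable_funPT.
Qed.

(** The threshold may vary with the key, so that edge and wedge hashes can be treated in one
    independent family. *)
Lemma prob_hash_le (J : {fset edge V + wedge V}) (a : edge V + wedge V -> R) :
  (forall k, 0 < a k < 1)%R ->
  P [set x | all (fun k => hash k x <= a k)%R J] = (\prod_(k <- J) a k)%:E.
Proof.
move=> a01; have [unif indep] := hash_random.
have -> : [set x | all (fun k => hash k x <= a k)%R J] =
    \bigcap_(k in [set` J]) (hash k @^-1` [set y | (y <= a k)%R]).
  apply/seteqP; split=> x /=; first by move/allP.
  by move=> xJ; apply/allP => k; exact: xJ.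
rewrite indep // -prodEFin; apply: eq_bigr => k _.
by rewrite -(uniform_prob_ray _ (a01 k)) -(unif k).
Qed.

End Hash.

Theorem theorem3p2 (R : realType) (d : measure_display)
  (T : measurableType d) (P : probability T R)
  (V : choiceType) (hash : edge V + wedge V -> {RV P >-> R})
  (hash_random : random_hash hash)
  (s : seq (edge V)) (alpha beta : R)
  (alpha01 : 0 < alpha < 1) (beta01 : 0 < beta < 1) (dt : nat)
  (Out : Type) (est : nat -> {fmap wedge V -> bool} -> Out)
  (t : nat) (t_range : (1 <= t <= size s)%N) :
  let state (x : T) : mg_state V :=
    (mg_triangle alpha beta dt est (fun k => hash k x) s t).1 in
  ('E_P[fun x => (#|` e_list (state x)|)%fset%:R]
     = (alpha * (#|` graph s 1 t|)%fset%:R)%:E)%E /\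
  ('E_P[fun x => (#|` w_list (state x)|)%fset%:R]
     = (alpha ^+ 2 * beta * (#|` wedges (graph s 1 t)|)%fset%:R)%:E)%E.
Proof.
move=> state.
pose a (k : edge V + wedge V) := if k is inl _ then alpha else beta.
have a01 k : 0 < a k < 1 by case: k.
have sum_cst (I : choiceType) (S : {fset I}) (c : R) :
    (\sum_(i <- S) c%:E)%E = (c * (#|` S|)%fset%:R)%:E.
  by rewrite sumEFin big_const_seq count_predT iter_addr_0 mulr_natr.
split.
  under eq_fun do rewrite /state e_list_mg_triangle.
  rewrite expectation_card_filter; last by move=> e; exact: measurable_hash_le.
  rewrite -sum_cst; apply: eq_bigr => e _.
  have := prob_hash_le hash hash_random [fset inl e]%fset a a01.
  rewrite big_seq_fset1 /= => <-; congr (P _).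
  apply/seteqP; split=> x /= hx; first by apply/allP => k /fset1P ->.
  by move/allP: hx => /(_ (inl e)); apply; rewrite fset11.
under eq_fun do rewrite /state w_list_mg_triangle.
(* The keys whose hashes decide whether [w] is listed: its own and those of its legs. *)
pose J (w : wedge V) := (inr w |` [fset inl e | e in legs w])%fset.
have JE w x : (hash (inr w) x <= beta) &&
    all (fun e => hash (inl e) x <= alpha) (legs w) =
    all (fun k => hash k x <= a k) (J w).
  apply/andP/allP => [[hw /allP hl] k|hJ].
    by rewrite in_fset1U => /orP[/eqP -> //|/imfsetP[e /= ew ->]]; exact: hl.
  split; first by apply: (hJ (inr w)); rewrite fset1U1.
  apply/allP => e ew; apply: (hJ (inl e)).
  by rewrite in_fset1U; apply/orP; right; apply/imfsetP; exists e.
rewrite expectation_card_filter => [|w]; last first.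
  (* Measurability: the event is a finite intersection of hash events. *)
  have -> : [set x | (hash (inr w) x <= beta) &&
      all (fun e => hash (inl e) x <= alpha) (legs w)]%classic =
      ([set x | hash (inr w) x <= beta] `&`
       \bigcap_(e in [set` legs w]) [set x | hash (inl e) x <= alpha])%classic.
    apply/seteqP; split=> x /=.
      by move=> /andP[hw /allP hl]; split.
    by move=> [-> hl] /=; apply/allP => e; exact: hl.
  apply: measurableI; first exact: measurable_hash_le.
  by apply: fin_bigcap_measurable => // e _; exact: measurable_hash_le.
rewrite -sum_cst; apply: eq_bigr => w _.
(* The wedge key gives [beta] and each of the two legs gives [alpha]; the three keys are distinct
   because [inl] is injective and never meets [inr]. *)
have -> : alpha ^+ 2 * beta = \prod_(k <- J w) a k.
  rewrite /J big_fsetU1 /=; last by apply/imfsetP => -[].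
  rewrite big_imfset /=; last by move=> e f _ _ [].
  by rewrite mulrC big_const_seq count_predT card_legs iter_mulr_1.
rewrite -(prob_hash_le hash hash_random _ _ a01); congr (P _).
by apply/seteqP; split=> x /=; rewrite JE.
Qed.
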